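(* Let $S,T$ be two lattices that have a maximum element, let $X,Y$ be arbitrary nonempty sets, and let $\mathcal{F}\subset S^Y$ (resp. $\mathcal{G}\subset T^X$) be a lattice of functions containing all the Dirac functions of $S^Y$ (resp. $T^X$). Let $B:\mathcal{F}\to\mathcal{G}$ and $B^\circ:\mathcal{G}\to\mathcal{F}$ be maps. Then $(B,B^\circ)$ is a dual Galois connection between $\mathcal{F}$ and $\mathcal{G}$ if, and only if, there exist two maps $b:X\times Y\times S\to T$ and $b^\circ:Y\times X\times T\to S$ such that: (i) for all $(x,y)\in X\times Y$, $(b(x,y,\cdot),b^\circ(y,x,\cdot))$ is a dual Galois connection between $S$ and $T$; (ii) for all $(x,t)\in X\times T$, $b^\circ(\cdot,x,t)\in\mathcal{F}$; (iii) for all $(y,s)\in Y\times S$, $b(\cdot,y,s)\in\mathcal{G}$; (iv) $Bf=\sup_{\mathcal{G}}\{b(\cdot,y,f(y))\mid y\in Y\}$ for all $f\in\mathcal{F}$, and $B^\circ g=\sup_{\mathcal{F}}\{b^\circ(\cdot,x,g(x))\mid x\in X\}$ for all $g\in\mathcal{G}$. In this case, the maps $b$ and $b^\circ$ are uniquely determined by $(B,B^\circ)$, since $b(\cdot,y,s)=B\delta_y^s$ and $b^\circ(\cdot,x,t)=B^\circ\delta_x^t$ for all $s\in S$, $t\in T$, $x\in X$ and $y\in Y$.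
   Context: For partially ordered sets $(\mathcal{F},\leq)$, $(\mathcal{G},\leq)$ and maps $B:\mathcal{F}\to\mathcal{G}$, $C:\mathcal{G}\to\mathcal{F}$, the pair $(B,C)$ is a dual Galois connection between $\mathcal{F}$ and $\mathcal{G}$ if for all $f\in\mathcal{F}$, $g\in\mathcal{G}$: $g\geq Bf \iff f\geq Cg$. (Given $B$, there is at most one such $C$; it is denoted $B^\circ$.) If $(S,\leq)$ is a lattice and $Y$ a set, $S^Y$ (all functions $Y\to S$) carries the product (pointwise) order, and a lattice of functions is a sublattice of $S^Y$, with the induced order. If $S$ has maximum element $\top_S$, $y\in Y$ and $s\in S$, the Dirac function $\delta_y^s\in S^Y$ is given by $\delta_y^s(y)=s$ and $\delta_y^s(y')=\top_S$ for $y'\neq y$; similarly for $\delta_x^t\in T^X$. $\sup_{\mathcal{G}}$ (resp. $\sup_{\mathcal{F}}$) denotes the least upper bound in the ordered set $\mathcal{G}$ (resp. $\mathcal{F}$); an identity involving it includes the assertion that this least upper bound exists. *)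

(* Defs.v *)
From HB Require Import structures.
From mathcomp Require Import all_boot all_order.
From mathcomp Require Import boolp classical_sets.

Set Implicit Arguments.
Unset Strict Implicit.
Unset Printing Implicit Defensive.

Import Order.TTheory.
Local Open Scope classical_set_scope.
Local Open Scope order_scope.

(* Applied to [F : set (Y -> S)], seen as the type [set_type F]; the ambient
   order on [Y -> S] is the pointwise order of [FunOrder]. *)
HB.instance Definition _ (d : Order.disp_t) (P : porderType d) (A : set P) :=
  [SubChoice_isSubPOrder of {x : P | x \in A} by <: with d].

Definition dual_galois (d d' : Order.disp_t) (P : porderType d)
    (Q : porderType d') (B : P -> Q) (C : Q -> P) : Prop :=
  forall (f : P) (g : Q), (g >= B f) <-> (f >= C g).

Definition lattice_of_functions (Y : Type) (d : Order.disp_t)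
    (S : latticeType d) (F : set (Y -> S)) : Prop :=
  forall f g : Y -> S, F f -> F g -> F (f `&` g) /\ F (f `|` g).

Definition dirac (Y : Type) (d : Order.disp_t) (S : tLatticeType d)
    (y : Y) (s : S) : Y -> S :=
  fun y' => if `[< y' = y >] then s else \top.

Definition contains_diracs (Y : Type) (d : Order.disp_t) (S : tLatticeType d)
    (F : set (Y -> S)) : Prop :=
  forall (y : Y) (s : S), dirac y s \in F.

Definition dirac_in (Y : Type) (d : Order.disp_t) (S : tLatticeType d)
    (F : set (Y -> S)) (hF : contains_diracs F) (y : Y) (s : S) : F :=
  exist _ (dirac y s) (hF y s).

Section Kernels.
Variables (X Y : Type) (d d' : Order.disp_t).
Variables (S : latticeType d) (T : latticeType d').
Variables (F : set (Y -> S)) (G : set (X -> T)).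

(* In the last two clauses [val @^-1` A] is the set [A] of functions, seen
   inside the ordered set [G] (resp. [F]); nothing is lost when [A] is a subset
   of [G] (resp. [F]), which the two preceding clauses guarantee. *)
Definition kernels (B : F -> G) (Bo : G -> F)
    (b : X -> Y -> S -> T) (bo : Y -> X -> T -> S) : Prop :=
  [/\ forall (x : X) (y : Y), dual_galois (b x y) (bo y x),
      forall (x : X) (t : T), F (fun y => bo y x t),
      forall (y : Y) (s : S), G (fun x => b x y s) &
      (forall f : F,
         isLub (val @^-1` [set (fun x => b x y (val f y)) | y in [set: Y]])
               (B f)) /\
      (forall g : G,
         isLub (val @^-1` [set (fun y => bo y x (val g x)) | x in [set: X]])
               (Bo g))].

End Kernels.

(* Main.v *)
Require Import Defs.
From mathcomp Require Import all_boot all_order.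
From mathcomp Require Import boolp classical_sets.

(** If [B f] is the supremum of the functions [b(.,y,f y)], then [B f <= g] iff
    [b x y (f y) <= g x] for all [x] and [y]; condition (i) turns this into the
    same criterion for [Bo g <= f]. Conversely, [f <= dirac y s] iff [f y <= s],
    so a dual Galois connection [(B, Bo)], evaluated on Dirac functions,
    restricts to one between [S] and [T] for each pair [(x, y)]. *)

Set Implicit Arguments.
Unset Strict Implicit.

Import Order.TTheory.
Local Open Scope classical_set_scope.
Local Open Scope order_scope.

Lemma le_setP (Y : Type) (d : Order.disp_t) (S : porderType d)
    (F : set (Y -> S)) (f g : F) :
  f <= g <-> forall y, val f y <= val g y.
Proof. by rewrite -Order.le_val; split=> /asboolP. Qed.

Lemma dual_galois_sym (d d' : Order.disp_t) (P : porderType d)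
    (Q : porderType d') (B : P -> Q) (C : Q -> P) :
  dual_galois B C -> dual_galois C B.
Proof. by move=> BC g f; have [? ?] := BC f g; split. Qed.

Lemma dual_galois_anti (d d' : Order.disp_t) (P : porderType d)
    (Q : porderType d') (B : P -> Q) (C : Q -> P) (f f' : P) :
  dual_galois B C -> f <= f' -> B f' <= B f.
Proof. by move=> BC ff'; apply/BC/(le_trans _ ff')/BC. Qed.

(** The adjoint inequality [C q <= \top] is automatic. Applied to [b x y'], this says that a point
    where a Dirac function equals [\top] adds nothing to a supremum. *)
Lemma dual_galois_top (d d' : Order.disp_t) (P : tPOrderType d)
    (Q : porderType d') (B : P -> Q) (C : Q -> P) (q : Q) :
  dual_galois B C -> B \top <= q.
Proof. by move=> BC; apply/BC; exact: lex1. Qed.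

Lemma diracE (Y : Type) (d : Order.disp_t) (S : tLatticeType d) (y : Y)
    (s : S) :
  dirac y s y = s.
Proof. by rewrite /dirac; case: asboolP. Qed.

(** Away from [y] the bound is [\top], so only the value at [y] is constrained. Pointwise
    inequalities thus become inequalities in [F], to which a Galois connection applies. *)
Lemma le_diracP (Y : Type) (d : Order.disp_t) (S : tLatticeType d)
    (F : set (Y -> S)) (dF : contains_diracs F) (f : F) (y : Y) (s : S) :
  f <= dirac_in dF y s <-> val f y <= s.
Proof.
rewrite le_setP; split=> [/(_ y)|fys y'] /=; first by rewrite diracE.
by rewrite /dirac; case: asboolP => [->|_] //; exact: lex1.
Qed.

Lemma ubound_kernelP (X Y : Type) (d d' : Order.disp_t) (S : latticeType d)
    (T : latticeType d') (G : set (X -> T)) (b : X -> Y -> S -> T)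
    (f : Y -> S) (g : G) :
  (forall y s, G (fun x => b x y s)) ->
  ubound (val @^-1` [set (fun x => b x y (f y)) | y in [set: Y]]) g <->
  forall x y, b x y (f y) <= val g x.
Proof.
move=> Gb; split=> [ubg x y|bg h [y _ hE]]; last first.
  by apply/le_setP => x; rewrite -hE.
(* An upper bound in [G] dominates only elements of [G], so the section [b(.,y,f y)] is first
   packaged as one. *)
pose h : G := @exist _ (fun h => h \in G) _ (mem_set (Gb y (f y))).
by have /le_setP/(_ x) : h <= g by apply: ubg; exists y.
Qed.

Section Kernels.
Variables (X Y : Type) (d d' : Order.disp_t).
Variables (S : tLatticeType d) (T : tLatticeType d').
Variables (F : set (Y -> S)) (G : set (X -> T)).
Implicit Types (B : F -> G) (Bo : G -> F).
Implicit Types (b : X -> Y -> S -> T) (bo : Y -> X -> T -> S).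

Lemma kernel_leP B Bo b bo (f : F) (g : G) :
  kernels B Bo b bo -> B f <= g <-> forall x y, b x y (val f y) <= val g x.
Proof.
move=> [_ _ Gb [/(_ f) [ubB lubB] _]]; split=> [Bfg x y|bg].
  have /(ubound_kernelP _ _ Gb)/(_ x y) := ubB.
  by move/le_trans; apply; move/le_setP: Bfg.
by apply: lubB; apply/ubound_kernelP.
Qed.

(** For a Dirac function, the family in (iv) consists of [b(.,y,s)] and of functions [b(.,y',\top)],
    which are least; its supremum is therefore [b(.,y,s)]. *)
Lemma kernel_dirac (dF : contains_diracs F) B Bo b bo (y : Y) (s : S) :
  kernels B Bo b bo -> (fun x => b x y s) = val (B (dirac_in dF y s)).
Proof.
move=> K; have [bbo _ Gb _] := K.
pose h : G := @exist _ (fun h => h \in G) _ (mem_set (Gb y s)).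
suff -> : B (dirac_in dF y s) = h by [].
apply: le_anti; apply/andP; split.
  apply/(kernel_leP _ _ K) => x y' /=; rewrite /dirac.
  case: asboolP => [-> //|_]; exact: (dual_galois_top _ (bbo x y')).
apply/le_setP => x.
(* Reflexivity, read through the criterion at index [y], bounds [b x y s] by the value of the
   supremum at [x]. *)
have /(kernel_leP _ _ K)/(_ x y) := lexx (B (dirac_in dF y s)).
by rewrite /= diracE.
Qed.

(** In [F], [f] is the infimum of the Dirac functions [dirac y (f y)], and a dual Galois connection
    turns infima into suprema. *)
Lemma dual_galois_isLub (dF : contains_diracs F) B Bo (f : F) :
  dual_galois B Bo ->
  isLub (val @^-1` [set (fun x => val (B (dirac_in dF y (val f y))) x)
                   | y in [set: Y]]) (B f).
Proof.
move=> BBo.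
pose b x y s := val (B (dirac_in dF y s)) x.
have Gb y s : G (fun x => b x y s).
  exact: set_mem (valP (B _)).
split=> [|g].
  apply/(ubound_kernelP _ _ Gb).
  move=> x y; move: x; apply/le_setP/(dual_galois_anti BBo).
  by apply/le_diracP.
move/(ubound_kernelP _ _ Gb) => ubg.
apply/BBo/le_setP => y; apply/(le_diracP dF)/BBo/le_setP => x.
exact: ubg.
Qed.

End Kernels.

(** Conditions (i) to (iv) are self-dual, so each fact about [B] and [b] also yields the one about
    [Bo] and [bo]. *)
Lemma kernels_sym (X Y : Type) (d d' : Order.disp_t)
    (S : latticeType d) (T : latticeType d')
    (F : set (Y -> S)) (G : set (X -> T)) (B : F -> G) (Bo : G -> F)
    (b : X -> Y -> S -> T) (bo : Y -> X -> T -> S) :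
  kernels B Bo b bo -> kernels Bo B bo b.
Proof.
by case=> bbo Fbo Gb [? ?]; split=> // y x; exact: dual_galois_sym.
Qed.

Unset Implicit Arguments.

Theorem theorem2p1 (d d' : Order.disp_t)
    (S : tLatticeType d) (T : tLatticeType d')
    (X Y : Type) (hX : inhabited X) (hY : inhabited Y)
    (F : set (Y -> S)) (G : set (X -> T))
    (hF : lattice_of_functions F) (hG : lattice_of_functions G)
    (dF : contains_diracs F) (dG : contains_diracs G)
    (B : F -> G) (Bo : G -> F) :
  (dual_galois B Bo <->
     exists (b : X -> Y -> S -> T) (bo : Y -> X -> T -> S), kernels B Bo b bo)
  /\ (forall (b : X -> Y -> S -> T) (bo : Y -> X -> T -> S),
        kernels B Bo b bo ->
        (forall (y : Y) (s : S),
           (fun x => b x y s) = val (B (dirac_in dF y s)))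
        /\ (forall (x : X) (t : T),
              (fun y => bo y x t) = val (Bo (dirac_in dG x t))))
  /\ (forall (b b' : X -> Y -> S -> T) (bo bo' : Y -> X -> T -> S),
        kernels B Bo b bo -> kernels B Bo b' bo' -> b = b' /\ bo = bo').
Proof.
have diracK b bo : kernels B Bo b bo ->
    (forall y s, (fun x => b x y s) = val (B (dirac_in dF y s))) /\
    (forall x t, (fun y => bo y x t) = val (Bo (dirac_in dG x t))).
  move=> K; split=> *; first exact: kernel_dirac K.
  exact: kernel_dirac (kernels_sym K).
split; last first.
  split=> // b b' bo bo' /diracK [bE boE] /diracK [b'E bo'E].
  split; apply/funext => z; apply/funext => w; apply/funext => u.
    by have := b'E w u; rewrite -bE => /(congr1 (@^~ z)).
  by have := bo'E w u; rewrite -boE => /(congr1 (@^~ z)).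
split=> [BBo|[b [bo K]] f g].
  exists (fun x y s => val (B (dirac_in dF y s)) x).
  exists (fun y x t => val (Bo (dirac_in dG x t)) y).
  split; [move=> x y s t|move=> x t|move=> y s|split].
  (* Both sides of (i) become comparisons with Dirac functions: this is [BBo] at [dirac y s] and
     [dirac x t]. *)
  - by rewrite -!le_diracP; exact: BBo.
  - exact: set_mem (valP (Bo _)).
  - exact: set_mem (valP (B _)).
  - by move=> f; exact: dual_galois_isLub BBo.
  - by move=> g; exact: dual_galois_isLub (dual_galois_sym BBo).
have [bbo _ _ _] := K.
have Ks := kernels_sym K.
rewrite (kernel_leP _ _ K) (kernel_leP _ _ Ks).
by split=> h ? ?; apply/bbo.
Qed.
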